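(* Let $u^k$, $k=1,\ldots,K$, be the solution of the time-discrete scheme, that is, $u^0=u_0$, each $u^{k}$ with $k\ge 1$ belongs to $D(A)=H^1_0(\Omega)\cap H^2(\Omega)$, $$u^1+\alpha_0 Au^1=\alpha_0 f^1+u^0,$$ and, for $1\le k\le K-1$, $$u^{k+1}+\alpha_0 Au^{k+1}=\alpha_0 f^{k+1}+(1-b_1)u^k+\sum_{j=1}^{k-1}(b_j-b_{j+1})u^{k-j}+b_ku^0 .$$ Then $$\Vert u^k\Vert\le \Vert u^0\Vert+\alpha_0\,k\,\Vert f\Vert_{L^\infty},\qquad k=1,2,\ldots,K.$$
   Context: Let $0<\alpha<1$, $T>0$, and let $\Omega\subset\mathbb{R}^d$, $1\le d\le 3$, be a bounded open domain. Let $A=-\Delta$ with domain $D(A)=H^1_0(\Omega)\cap H^2(\Omega)$ (homogeneous Dirichlet boundary conditions). Here $u_0\in L^2(\Omega)$ is the initial datum and $f$ is the source term, with $f(t)\in L^2(\Omega)$ for $t\in[0,T]$, of the problem ${}^C_0D^\alpha_t u+Au=f$, $u(0)=u_0$, where ${}^C_0D^\alpha_t$ is the Caputo time derivative of order $\alpha$. Time grid: $K\ge 1$ is an integer, $\Delta t=T/K$, $t_k=k\Delta t$ for $k=0,1,\ldots,K$, and $f^{k}=f(t_{k})$. Coefficients: $b_j=(j+1)^{1-\alpha}-j^{1-\alpha}$ for $j\ge 0$, and $\alpha_0=\Gamma(2-\alpha)\,\Delta t^{\alpha}$, where $\Gamma$ is the Gamma function. Empty sums are zero. Norms: $\Vert\cdot\Vert$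 is the $L^2(\Omega)$ norm, and $\Vert f\Vert_{L^\infty}=\sup_{t\in[0,T]}\Vert f(t)\Vert$, assumed finite. *)

(* Defs.v *)
From HB Require Import structures.
From mathcomp Require Import all_boot all_order all_algebra.
From mathcomp Require Import all_classical all_reals all_analysis.
From mathcomp Require Import measurable_realfun.
Set Implicit Arguments.
Unset Strict Implicit.
Unset Printing Implicit Defensive.
Import Order.TTheory GRing.Theory Num.Theory.
Import numFieldNormedType.Exports.
Local Open Scope classical_set_scope.
Local Open Scope ring_scope.

(* R^n with its Borel sigma-algebra *)
HB.instance Definition _ (R : realType) (n : nat) :=
  @isMeasurable.Build default_measure_display 'rV[R]_n
    <<s (@open 'rV[R]_n) >>
    (@measurable0 _ (g_sigma_algebraType (@open 'rV[R]_n)))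
    (@measurableC _ (g_sigma_algebraType (@open 'rV[R]_n)))
    (@bigcupT_measurable _ (g_sigma_algebraType (@open 'rV[R]_n))).

Lemma open_measurable_rV (R : realType) (n : nat) (A : set 'rV[R]_n) :
  open A -> measurable A.
Proof. exact: sub_sigma_algebra. Qed.

Lemma measurable_coord_rV (R : realType) (n : nat) (i : 'I_n) :
  measurable_fun [set: 'rV[R]_n] (fun x : 'rV[R]_n => x 0 i).
Proof.
apply: (measurability _ (RGenOpens.measurableE R)).
move=> _ [_ [a [b ->]] <-]; rewrite setTI; apply: open_measurable_rV.
by apply: open_comp => [x _|]; [exact: coord_continuous|exact: interval_open].
Qed.

Lemma measurable_fun_rV (d : measure_display) (T : measurableType d)
    (R : realType) (n : nat) (f : T -> 'rV[R]_n) :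
  (forall i, measurable_fun [set: T] (fun x => f x 0 i)) ->
  measurable_fun [set: T] f.
Proof.
move=> mf.
have mball (y : 'rV[R]_n) (e : R) : 0 < e -> measurable (f @^-1` ball y e).
  move=> e0; rewrite (_ : _ @^-1` _ =
      \bigcap_(i in [set: 'I_n]) ((fun x => f x 0 i) @^-1` ball (y 0 i) e)).
    apply: fin_bigcap_measurable => // i _; rewrite -[X in measurable X]setTI.
    by apply: mf => //; exact: measurable_ball.
  apply/seteqP; split => x /=; first by move=> [_ H] i _; exact: H.
  by move=> H; split => // i j; rewrite ord1; exact: H.
pose qv (p : 'rV[rat]_n) : 'rV[R]_n := map_mx ratr p.
apply: (@measurability _ _ T 'rV[R]_n setT f (@open 'rV[R]_n) erefl).
move=> _ [U oU <-]; rewrite setTI.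
pose I := [set p : 'rV[rat]_n * rat | 0 < p.2 /\ ball (qv p.1) (ratr p.2) `<=` U].
rewrite (_ : f @^-1` U = \bigcup_(p in I) (f @^-1` ball (qv p.1) (ratr p.2))).
  rewrite bigcup_mkcond; apply: countable_bigcupT_measurable => // p.
  by case: ifPn => // /set_mem[p0 _]; apply: mball; rewrite ltr0q.
apply/seteqP; split => [x Ux|x [p [_ Ip]]]; last exact: Ip.
have : nbhs (f x) U by exact: open_nbhs_nbhs.
rewrite -nbhs_ballE => -[e /= e0 eU].
have /rat_in_itvoo[r] : 0 < e / 2 by rewrite divr_gt0.
rewrite in_itv/= => /andP[r0 re].
have /choice[q hq] : forall i, exists q : rat, ball (f x 0 i) (ratr r) (ratr q).
  move=> i; have /rat_in_itvoo[q] : f x 0 i - ratr r < f x 0 i + ratr r.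
    by rewrite ltrD2l gtrN.
  by move=> qi; exists q; rewrite ball_itv.
have fxq : ball (f x) (ratr r) (qv (\row_i q i)).
  by split => // i j; rewrite !ord1 !mxE; exact: hq.
exists (\row_i q i, r); last exact: ball_sym.
split => /=; first by rewrite -(ltr0q R).
move=> y qy; apply: eU; rewrite [e]splitr.
by apply: ball_triangle; apply: (le_ball (ltW re)); [exact: fxq|exact: qy].
Qed.

(* (x, (y_1, ..., y_n)) |-> (x, y_1, ..., y_n) *)
Definition cons_rV (R : realType) (n : nat) (p : R * 'rV[R]_n) : 'rV[R]_n.+1 :=
  \row_i if unlift ord0 i is Some j then p.2 0 j else p.1.

Definition uncons_rV (R : realType) (n : nat) (x : 'rV[R]_n.+1) : R * 'rV[R]_n :=
  (x 0 ord0, \row_j x 0 (lift ord0 j)).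

Lemma cons_rVK (R : realType) (n : nat) : cancel (@cons_rV R n) (@uncons_rV R n).
Proof.
move=> [x y]; rewrite /uncons_rV /cons_rV; congr pair.
  by rewrite mxE unlift_none.
by apply/rowP => j; rewrite !mxE liftK.
Qed.

Lemma measurable_cons_rV (R : realType) (n : nat) :
  measurable_fun setT (@cons_rV R n).
Proof.
apply: measurable_fun_rV => i.
under eq_fun do rewrite mxE.
case: unliftP => [j _|_]; last exact: measurable_fst.
exact: (measurableT_comp (@measurable_coord_rV R n j) measurable_snd).
Qed.

Lemma measurable_uncons_rV (R : realType) (n : nat) :
  measurable_fun setT (@uncons_rV R n).
Proof.
apply: measurable_fun_pair; first exact: measurable_coord_rV.
apply: measurable_fun_rV => i; under eq_fun do rewrite mxE.
exact: measurable_coord_rV.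
Qed.

Lemma sigma_finite_product_measure (d1 d2 : measure_display)
    (T1 : measurableType d1) (T2 : measurableType d2) (R : realType)
    (m1 : {sigma_finite_measure set T1 -> \bar R})
    (m2 : {sigma_finite_measure set T2 -> \bar R}) :
  sigma_finite setT (m1 \x m2)%E.
Proof.
have /sigma_finiteP[F [TF ndF Foo]] := sigma_finiteT m1.
have /sigma_finiteP[G [TG ndG Goo]] := sigma_finiteT m2.
exists (fun n => F n `*` G n).
  rewrite -setXTT TF TG predeqE => -[x y]; split.
    move=> [/= [n _ Fnx] [k _ Gky]]; exists (maxn n k) => //; split.
    - by move: x Fnx; exact/subsetPset/ndF/leq_maxl.
    - by move: y Gky; exact/subsetPset/ndG/leq_maxr.
  by move=> [n _ []/= ? ?]; split; exists n.
move=> k; have [? ?] := Foo k; have [? ?] := Goo k.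
split; first exact: measurableX.
by rewrite product_measure1E// lte_mul_pinfty// ge0_fin_numE.
Qed.

Section cons_measure.
Variables (R : realType) (n : nat).
Variable mu : {sigma_finite_measure set 'rV[R]_n -> \bar R}.

(* Lebesgue measure on R times mu, transported to R^(n+1) *)
Definition cons_measure : set 'rV[R]_n.+1 -> \bar R :=
  pushforward (@lebesgue_measure R \x mu)%E (@cons_rV R n).

Let mpre A : measurable A -> measurable (@cons_rV R n @^-1` A).
Proof.
by move=> mA; rewrite -[X in measurable X]setTI; exact: measurable_cons_rV.
Qed.

Let cons_measure0 : cons_measure set0 = 0%E.
Proof. by rewrite /cons_measure /pushforward preimage_set0 measure0. Qed.

Let cons_measure_ge0 A : (0 <= cons_measure A)%E.
Proof. exact: integral_ge0. Qed.

Let cons_measure_sigma_additive : semi_sigma_additive cons_measure.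
Proof.
move=> F mF tF mUF; rewrite /cons_measure /pushforward preimage_bigcup.
apply: measure_semi_sigma_additive.
- by move=> i; exact: mpre.
- apply/trivIsetP => /= i j _ _ ij; rewrite -preimage_setI.
  by move/trivIsetP : tF => /(_ _ _ _ _ ij) ->//; rewrite preimage_set0.
- by rewrite -preimage_bigcup; exact: mpre.
Qed.

HB.instance Definition _ := isMeasure.Build _ _ _ cons_measure
  cons_measure0 cons_measure_ge0 cons_measure_sigma_additive.

Let cons_measure_sigma_finite : sigma_finite setT cons_measure.
Proof.
have [F FT Foo] : sigma_finite setT (@lebesgue_measure R \x mu)%E.
  exact: sigma_finite_product_measure.
exists (fun i => @uncons_rV R n @^-1` F i).
  by rewrite -preimage_bigcup -FT preimage_setT.
move=> i; have [mFi Fioo] := Foo i; split.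
  by rewrite -[X in measurable X]setTI; exact: measurable_uncons_rV.
rewrite /cons_measure /pushforward -comp_preimage.
by rewrite (_ : _ \o _ = id)//; apply/funext => x /=; rewrite cons_rVK.
Qed.

HB.instance Definition _ := Measure_isSigmaFinite.Build _ _ _ cons_measure
  cons_measure_sigma_finite.

End cons_measure.

(* n-dimensional Lebesgue measure *)
Fixpoint lebesgue_measure_rV (R : realType) (n : nat) :
    {sigma_finite_measure set 'rV[R]_n -> \bar R} :=
  if n is m.+1 then cons_measure (lebesgue_measure_rV R m)
  else \d_(0 : 'rV[R]_0).

Lemma lebesgue_measure_rV_box (R : realType) (n : nat) (a b : 'rV[R]_n) :
  (forall i, a 0 i <= b 0 i) ->
  lebesgue_measure_rV R n [set x | forall i, x 0 i \in `[a 0 i, b 0 i]] =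
  (\prod_(i < n) (b 0 i - a 0 i))%:E.
Proof.
elim: n a b => [|n IHn] a b ab.
  by rewrite big_ord0 /= diracE mem_set// => -[].
rewrite /= /cons_measure /pushforward.
pose a' : 'rV[R]_n := \row_j a 0 (lift ord0 j).
pose b' : 'rV[R]_n := \row_j b 0 (lift ord0 j).
pose B := [set x : 'rV[R]_n | forall i, x 0 i \in `[a' 0 i, b' 0 i]].
rewrite (_ : _ @^-1` _ = `[a 0 ord0, b 0 ord0]%classic `*` B); last first.
  apply/seteqP; split => [[x y] /= H|[x y] /= [H1 H2] i].
    split; first by have := H ord0; rewrite mxE unlift_none.
    by move=> i; have := H (lift ord0 i); rewrite !mxE liftK.
  rewrite mxE; case: unliftP => [j ->|->//].
  by have := H2 j; rewrite !mxE.
have mB : measurable B.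
  rewrite (_ : B = \bigcap_(i in [set: 'I_n])
      ((fun x : 'rV[R]_n => x 0 i) @^-1` `[a' 0 i, b' 0 i]%classic)).
    apply: fin_bigcap_measurable => // i _; rewrite -[X in measurable X]setTI.
    exact: measurable_coord_rV.
  by apply/seteqP; split => x /= H i; [move=> _|]; exact: H.
rewrite product_measure1E// IHn; last by move=> i; rewrite !mxE.
rewrite big_ord_recl /= lebesgue_measure_itv/= lte_fin EFinM.
congr (_ * _)%E.
  have := ab ord0; rewrite le_eqVlt => /orP[/eqP->|->//].
  by rewrite ltxx subrr.
by congr EFin; apply: eq_bigr => i _; rewrite !mxE.
Qed.

Section sobolev.
Variables (R : realType) (n : nat).
Implicit Types phi : 'rV[R]_n -> R.

(* i-th vector of the canonical basis of R^n *)
Definition e_ (i : 'I_n) : 'rV[R]_n := delta_mx 0 i.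

Fixpoint Cn (k : nat) phi : Prop :=
  if k is k'.+1 then
    [/\ continuous phi, forall i x, derivable phi x (e_ i)
      & forall i, Cn k' ('D_(e_ i) phi)]
  else continuous phi.

(* C^oo functions whose support is a compact subset of Omega *)
Definition test_function (Omega : set 'rV[R]_n) phi : Prop :=
  [/\ forall k, Cn k phi,
      compact (closure [set x | phi x != 0])
    & closure [set x | phi x != 0] `<=` Omega].

Variables (Omega : set 'rV[R]_n) (oOmega : open Omega).

(* Lebesgue measure restricted to Omega *)
Definition lebesgue_on : {measure set 'rV[R]_n -> \bar R} :=
  mrestr (lebesgue_measure_rV R n) (open_measurable_rV oOmega).

(* Square-integrable functions. They are not identified when they are equal
   almost everywhere on Omega, and their values outside Omega are irrelevant:
   equality in L^2(Omega) is [u = v %[ae lebesgue_on oOmega]]. *)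
Definition L2 : Type := LfunType lebesgue_on (lee1n 2).

Definition L2norm (u : L2) : R := fine ('N[lebesgue_on]_2%:E[EFin \o u])%E.

Definition weak_partial (i : 'I_n) (u g : L2) : Prop :=
  forall phi, test_function Omega phi ->
    \int[lebesgue_on]_x (u x * 'D_(e_ i) phi x) =
    - \int[lebesgue_on]_x (g x * phi x).

(* A weak partial derivative is unique up to almost everywhere equality; the
   value is junk (0) when there is none in L^2(Omega). *)
Definition wpartial (i : 'I_n) (u : L2) : L2 :=
  xget 0 [set g | weak_partial i u g].

(* H^m(Omega) *)
Fixpoint Sobolev (m : nat) (u : L2) : Prop :=
  if m is m'.+1 then
    forall i, (exists g, weak_partial i u g) /\ Sobolev m' (wpartial i u)
  else True.

(* squared H^1(Omega) norm of u - phi *)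
Definition H1dist2 (u : L2) phi : \bar R :=
  ('N[lebesgue_on]_2%:E[EFin \o (u \- phi)%R] ^+ 2 +
   \sum_(i < n)
     'N[lebesgue_on]_2%:E[EFin \o (wpartial i u \- 'D_(e_ i) phi)%R] ^+ 2)%E.

(* H^1_0(Omega) is the closure in H^1(Omega) of the test functions *)
Definition H10 (u : L2) : Prop :=
  Sobolev 1 u /\
  forall e : R, 0 < e ->
    exists2 phi, test_function Omega phi & (H1dist2 u phi < (e ^+ 2)%:E)%E.

(* D(A) for A = - Laplacian with homogeneous Dirichlet boundary conditions *)
Definition domA (u : L2) : Prop := H10 u /\ Sobolev 2 u.

Definition negLaplacian (u : L2) : L2 := - \sum_(i < n) wpartial i (wpartial i u).

(* sup_(0 <= t <= T) ||f t|| *)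
Definition Linfty_norm (T : R) (f : R -> L2) : R :=
  sup [set L2norm (f t) | t in `[0, T]].

End sobolev.

Definition Gamma (R : realType) (x : R) : R :=
  \int[lebesgue_measure]_(t in `]0, +oo[) (t `^ (x - 1) * expR (- t)).

Definition b_ (R : realType) (alpha : R) (j : nat) : R :=
  j.+1%:R `^ (1 - alpha) - j%:R `^ (1 - alpha).

(* Main.v *)
(* Pairing one step of the scheme with its solution [w] and dropping the
   nonnegative term [alpha0 (A w, w)] gives [||w|| <= ||right-hand side||] by
   Cauchy-Schwarz. Since [t |-> t^(1 - alpha)] is concave, the right-hand side is
   [alpha0 f^(k+1)] plus a convex combination of [u^0, ..., u^k], and the bound
   follows by induction. Positivity of [A] on [D(A)] is
   [(A w, w) = sum_i ||d_i w||^2], obtained by approximating [w] in [H^1] by test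
   functions. *)
Require Import Defs.
From mathcomp Require Import all_boot all_order all_algebra.
From mathcomp Require Import all_classical all_reals all_analysis.
From mathcomp Require Import measurable_realfun lra.
Set Implicit Arguments.
Unset Strict Implicit.
Unset Printing Implicit Defensive.
Import Order.TTheory GRing.Theory Num.Theory.
Import numFieldNormedType.Exports.
Local Open Scope classical_set_scope.
Local Open Scope ring_scope.

(** * The inner product and norm of $L^2$ *)

Section L2_inner_product.
Context {d : measure_display} {T : measurableType d} {R : realType}.
Variable mu : {measure set T -> \bar R}.
Local Notation L := (LfunType mu (lee1n 2)).
Local Notation nm f := (fine 'N[mu]_2%:E[EFin \o f]).
Implicit Types u v w h : L.

Definition L2dot u v : R := \int[mu]_x (u x * v x).

Lemma L2_mul_integrable u v : mu.-integrable setT (EFin \o (fun x => u x * v x)).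
Proof. by apply/Lfun1_integrable/Lfun2_mul_Lfun1; exact: LfunP. Qed.

Lemma L2dotC u v : L2dot u v = L2dot v u.
Proof. by apply: eq_Rintegral => x _; rewrite mulrC. Qed.

Lemma L2dotDl u v w : L2dot (u + v) w = L2dot u w + L2dot v w.
Proof.
rewrite /L2dot -RintegralD//; [|exact: L2_mul_integrable..].
by apply: eq_Rintegral => x _ /=; rewrite -mulrDl.
Qed.

Lemma L2dotZl a u v : L2dot (a *: u) v = a * L2dot u v.
Proof.
rewrite /L2dot -RintegralZl//; last exact: L2_mul_integrable.
by apply: eq_Rintegral => x _ /=; rewrite mulrA.
Qed.

Lemma L2dotNl u v : L2dot (- u) v = - L2dot u v.
Proof. by rewrite -scaleN1r L2dotZl mulN1r. Qed.

Lemma L2dotBr u v w : L2dot u (v - w) = L2dot u v - L2dot u w.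
Proof. by rewrite L2dotC L2dotDl L2dotNl !(L2dotC _ u). Qed.

Lemma L2dot_suml (I : Type) (s : seq I) (F : I -> L) v :
  L2dot (\sum_(i <- s) F i) v = \sum_(i <- s) L2dot (F i) v.
Proof.
elim/big_ind2 : _ => [|x u y w <- <-|//].
  by rewrite -(scale0r v) L2dotZl mul0r.
exact: L2dotDl.
Qed.

(** The equations of the scheme hold only almost everywhere; integration turns them into exact
    equalities of reals. *)
Lemma L2dot_ae u v w : u = v %[ae mu] -> L2dot u w = L2dot v w.
Proof.
move=> uv; congr fine; apply: ae_eq_integral => //.
- by apply/measurable_EFinP; exact: measurable_funM.
- by apply/measurable_EFinP; exact: measurable_funM.
- by apply: filterS uv => x /(_ I) uv _; rewrite /= uv.
Qed.

Lemma L2dot_norm u : L2dot u u = nm u ^+ 2.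
Proof.
rewrite -powR_mulrn ?fine_ge0 ?Lnorm_ge0//.
apply: EFin_inj; rewrite -poweR_EFin finite_norm_fine powR_Lnorm//.
rewrite /L2dot /Rintegral fineK; last first.
  by apply: integrable_fin_num => //; exact: L2_mul_integrable.
apply: eq_integral => x _ /=.
by rewrite powR_mulrn// -normrX ger0_norm ?sqr_ge0// expr2.
Qed.

Lemma L2_cauchy_schwarz u v : `|L2dot u v| <= nm u * nm v.
Proof.
rewrite -lee_fin EFinM !finite_norm_fine EFin_normr_Rintegral//; last first.
  exact: L2_mul_integrable.
apply: (@le_trans _ _ 'N[mu]_1[EFin \o (u \* v)%R])%E.
  rewrite Lnorm1; apply: le_abse_integral => //.
  by apply/measurable_EFinP; exact: measurable_funM.
by apply: hoelder => //; lra.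
Qed.

Lemma L2_normZ a u : nm (a *: u) = `|a| * nm u.
Proof. by rewrite (LnormZ u a) -finite_norm_fine. Qed.

Lemma L2_normD u v : nm (u + v) <= nm u + nm v.
Proof. exact: ler_LnormD. Qed.

Lemma L2_norm_sum (I : Type) (s : seq I) (F : I -> L) :
  nm (\sum_(i <- s) F i) <= \sum_(i <- s) nm (F i).
Proof.
elim/big_rec2 : _ => [|i x u _ ux].
  by rewrite -(scale0r (0 : L)) L2_normZ normr0 mul0r.
by rewrite (le_trans (L2_normD _ _))// lerD2l.
Qed.

Lemma accretive_norm_le (a : R) u w h : 0 <= a -> 0 <= L2dot u w ->
  w + a *: u = h %[ae mu] -> nm w <= nm h.
Proof.
move=> a0 uw0 /(L2dot_ae w); rewrite L2dotDl L2dotZl L2dot_norm => E.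
have w0 : 0 <= nm w by rewrite fine_ge0// Lnorm_ge0.
(* The estimate is obtained after multiplication by [nm w], so a vanishing norm is treated apart. *)
move: (w0); rewrite le_eqVlt => /predU1P[<-|wgt0].
  by rewrite fine_ge0// Lnorm_ge0.
rewrite -(ler_pM2r wgt0) -expr2.
apply: le_trans (le_trans (ler_norm _) (L2_cauchy_schwarz h w)).
by rewrite -E lerDl mulr_ge0.
Qed.

End L2_inner_product.

Lemma continuous_measurable_rV (R : realType) (n : nat) (f : 'rV[R]_n -> R) :
  continuous f -> measurable_fun setT f.
Proof.
move=> cf; apply: (measurability _ (RGenOpens.measurableE R)).
move=> _ [_ [a [b ->]] <-]; rewrite setTI; apply: open_measurable_rV.
by apply: open_comp => [x _|]; [exact: cf|exact: interval_open].
Qed.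

(** * Positivity of the Dirichlet Laplacian *)

Section laplacian.
Context {R : realType} {n : nat} {Omega : set 'rV[R]_n} (oOmega : open Omega).
Local Notation L := (L2 oOmega).
Local Notation nm f := (fine 'N[lebesgue_on oOmega]_2%:E[EFin \o f]).

(** Repackages a bare function [phi] as an element of [L2], so that the inner product applies to it:
    [u - phi] is measurable with finite norm, and [phi = u - (u - phi)]. *)
Lemma L2_near_continuous (u : L) (phi : 'rV[R]_n -> R) (e : R) : 0 < e ->
  continuous phi ->
  ('N[lebesgue_on oOmega]_2%:E[EFin \o (u \- phi)%R] ^+ 2 < (e ^+ 2)%:E)%E ->
  exists2 v : L, v =1 phi & L2norm (u - v) < e.
Proof.
move=> e0 cphi H.
have N0 := Lnorm_ge0 (lebesgue_on oOmega) 2%:E (EFin \o (u \- phi)%R).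
have {}H : ('N[lebesgue_on oOmega]_2%:E[EFin \o (u \- phi)%R] < e%:E)%E.
  rewrite ltNge; apply/negP => eN; move: H; rewrite ltNge => /negP; apply.
  by rewrite EFin_expe !expe2 lee_pmul// lee_fin ltW.
have mu_ : measurable_fun setT (u \- phi).
  by apply: measurable_funB => //; exact: continuous_measurable_rV.
have dP : (u \- phi) \in Lfun (lebesgue_on oOmega) 2%:E.
  apply/andP; split; rewrite inE//=.
  by rewrite /finite_norm (lt_trans H)// ltry.
pose w : L := Lfun_Sub (lee1n 2) dP.
exists (u - w) => [x|]; first by rewrite /= opprB addrC subrK.
rewrite opprB addrC subrK /L2norm.
by rewrite -lte_fin finite_norm_fine.
Qed.

Lemma H1dist2_lt (u : L) phi (e : R) : (H1dist2 u phi < (e ^+ 2)%:E)%E ->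
  ('N[lebesgue_on oOmega]_2%:E[EFin \o (u \- phi)%R] ^+ 2 < (e ^+ 2)%:E)%E /\
  forall i, ('N[lebesgue_on oOmega]_2%:E
    [EFin \o (wpartial i u \- 'D_(e_ R i) phi)%R] ^+ 2 < (e ^+ 2)%:E)%E.
Proof.
move=> H; split => [|i]; apply: le_lt_trans H; rewrite /H1dist2.
  by rewrite leeDl// sume_ge0// => i _; exact: sqre_ge0.
rewrite (bigD1 i)//= addeC -addeA leeDl// adde_ge0//; last exact: sqre_ge0.
by apply: sume_ge0 => j _; exact: sqre_ge0.
Qed.

(* Integration by parts: the defining identity of the weak derivative extends
   from test functions to their closure [H^1_0]. *)
Lemma L2dot_wpartial2 (u : L) (i : 'I_n) : domA u ->
  L2dot (wpartial i (wpartial i u)) u = - L2norm (wpartial i u) ^+ 2.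
Proof.
move=> [[_ hu] /(_ i)[_ /(_ i)[[g0 g0P] _]]].
(* The second-order Sobolev condition supplies a witness [g0], so the choice made by [xget] is a
   genuine weak derivative and not the default value. *)
have gP : weak_partial i (wpartial i u) (wpartial i (wpartial i u)).
  by rewrite {2}/wpartial; exact: (xgetPex 0 (ex_intro _ _ g0P)).
move: gP; set v := wpartial i u in hu *; set g := wpartial i v => gP.
apply/eqP; rewrite -subr_eq0 opprK -normr_le0; apply/ler_addgt0Pl => e e0.
rewrite addr0.
(* The final error is at most [(L2norm g + L2norm v) * e']; the added 1 keeps the divisor of [e]
   positive. *)
have M0 : 0 < L2norm g + L2norm v + 1.
  by rewrite ltr_pwDr// addr_ge0// fine_ge0// Lnorm_ge0.
have e'0 : 0 < e / (L2norm g + L2norm v + 1) by rewrite divr_gt0.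
have [phi phiT] := hu _ e'0; set e' := e / _ in e'0 *.
move/H1dist2_lt => [H0 /(_ i) H1].
have [/(_ 2%N)/= [cphi _ /(_ i)[cDphi _ _]] _ _] := phiT.
have [p pE up] := L2_near_continuous e'0 cphi H0.
have [q qE vq] := L2_near_continuous e'0 cDphi H1.
(* Exact integration by parts against [phi]; subtracting it leaves only the approximation errors
   [u - p] and [v - q]. *)
have pq : L2dot g p + L2dot v q = 0.
  apply/eqP; rewrite addrC addr_eq0; apply/eqP.
  transitivity (\int[lebesgue_on oOmega]_x (v x * 'D_(e_ R i) phi x)).
    by apply: eq_Rintegral => x _; rewrite qE.
  by rewrite gP//; congr (- _); apply: eq_Rintegral => x _; rewrite pE.
rewrite /L2norm -L2dot_norm.
have -> : L2dot g u + L2dot v v = L2dot g (u - p) + L2dot v (v - q).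
  by rewrite !L2dotBr; lra.
rewrite (le_trans (ler_normD _ _))//.
rewrite (le_trans (lerD (L2_cauchy_schwarz _ _) (L2_cauchy_schwarz _ _)))//.
apply: (@le_trans _ _ (L2norm g * e' + L2norm v * e')).
  by apply: lerD; apply: ler_wpM2l; rewrite ?fine_ge0 ?Lnorm_ge0// ltW.
rewrite -mulrDl /e' mulrA ler_pdivrMr// mulrC ler_pM2l// lerDl.
by [].
Qed.

Lemma negLaplacian_ge0 (u : L) : domA u -> 0 <= L2dot (negLaplacian u) u.
Proof.
move=> uA; rewrite /negLaplacian L2dotNl L2dot_suml -sumrN sumr_ge0// => i _.
by rewrite L2dot_wpartial2// opprK sqr_ge0.
Qed.

End laplacian.

Lemma Gamma_ge0 (R : realType) (x : R) : 0 <= Gamma x.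
Proof.
by apply: Rintegral_ge0 => t _; rewrite mulr_ge0 ?powR_ge0 ?expR_ge0.
Qed.

(** * Sign and summation of the coefficients of the scheme *)

Section coefficients.
Context {R : realType} (alpha : R).
Hypothesis halpha : 0 < alpha < 1.
Local Notation p := (1 - alpha).

(* Young's inequality says that the tangent of [t |-> t `^ p] at [x + 1] lies
   above its graph; evaluate it at [x] and [x + 2] and add. *)
Lemma powR_midpoint (x : R) : 0 <= x ->
  x `^ p + (x + 2) `^ p <= 2 * (x + 1) `^ p.
Proof.
move=> x0; have /andP[a0 a1] := halpha.
have p0 : 0 < p by lra.
have b0 : 0 < x + 1 by lra.
(* The tangent inequality is multiplied by $(x+1)^\alpha$ to clear the negative power; the conjugate
   exponents are $1/p$ and $1/\alpha$. *)
have tangent t : 0 <= t -> t `^ p * (x + 1) `^ alpha <= p * t + alpha * (x + 1).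
  move=> t0.
  have := @conjugate_powR R (t `^ p) ((x + 1) `^ alpha) p^-1 alpha^-1.
  rewrite !powR_ge0 !invr_gt0 p0 a0 !invrK subrK => /(_ _ _ _ _ _)/(le_trans _).
  rewrite -!powRrM !mulfV ?gt_eqF// !powRr1// ?(ltW b0)//.
  by rewrite ![_ * p]mulrC [_ * alpha]mulrC; apply.
have c0 : 0 < (x + 1) `^ alpha by rewrite powR_gt0.
rewrite -(ler_pM2r c0) -mulrA -powRD ?subrK ?powRr1 ?(ltW b0)//; last first.
  by apply/implyP => _; rewrite gt_eqF.
have := tangent x x0; have := tangent (x + 2) ltac:(lra).
lra.
Qed.

Lemma b_0 : b_ alpha 0 = 1.
Proof.
have /andP[a0 a1] := halpha.
by rewrite /b_ powR1 powR0 ?subr0// gt_eqF//; lra.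
Qed.

Lemma b_ge0 j : 0 <= b_ alpha j.
Proof.
have /andP[a0 a1] := halpha.
rewrite /b_ subr_ge0 ge0_ler_powR ?nnegrE ?ler0n ?ler_nat//; lra.
Qed.

(** The difference of the two sides is the second difference of $t^{1-\alpha}$ at $j, j+1, j+2$,
    which midpoint concavity controls. *)
Lemma b_nonincreasing j : b_ alpha j.+1 <= b_ alpha j.
Proof.
have := @powR_midpoint j%:R (ler0n _ _).
by rewrite /b_ -(natrD _ j 2) addn2 natr1; lra.
Qed.

(* The weights [1 - b_1], [b_j - b_(j+1)] and [b_k] are nonnegative and
   telescope to [1]. *)
Lemma b_convex_combination_le (x : nat -> R) (M : R) (k : nat) : (0 < k)%N ->
  (forall j, (j <= k)%N -> x j <= M) ->
  (1 - b_ alpha 1) * x k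
    + \sum_(1 <= j < k) (b_ alpha j - b_ alpha j.+1) * x (k - j)%N
    + b_ alpha k * x 0%N <= M.
Proof.
move=> k0 xM.
apply: (@le_trans _ _ ((1 - b_ alpha 1) * M
    + \sum_(1 <= j < k) (b_ alpha j - b_ alpha j.+1) * M + b_ alpha k * M)).
  apply: lerD; last by rewrite ler_wpM2l ?b_ge0 ?xM.
  apply: lerD; first by rewrite ler_wpM2l ?xM// subr_ge0 -b_0 b_nonincreasing.
  apply: ler_sum_nat => j _.
  by rewrite ler_wpM2l ?xM ?leq_subr// subr_ge0 b_nonincreasing.
rewrite -mulr_suml -!mulrDl.
under eq_big_nat => j _ do rewrite -opprB.
by rewrite sumrN telescope_sumr//; lra.
Qed.

End coefficients.

(** * The stability bound, by induction on the time step *)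

Theorem theorem2p1 (R : realType) (d : nat) (hd : (1 <= d <= 3)%N)
    (Omega : set 'rV[R]_d) (oOmega : open Omega) (cOmega : connected Omega)
    (nOmega : Omega !=set0) (bOmega : bounded_set Omega)
    (alpha T : R) (halpha : 0 < alpha < 1) (hT : 0 < T)
    (K : nat) (hK : (1 <= K)%N)
    (u0 : L2 oOmega) (f : R -> L2 oOmega)
    (hf : has_ubound [set L2norm (f t) | t in `[0, T]])
    (u : nat -> L2 oOmega) :
  let dt := T / K%:R in
  let fk (k : nat) := f (k%:R * dt) in
  let b := b_ alpha in
  let alpha0 := Gamma (2 - alpha) * dt `^ alpha in
  u 0%N = u0 %[ae lebesgue_on oOmega] ->
  (forall k, (1 <= k <= K)%N -> domA (u k)) ->
  u 1%N + alpha0 *: negLaplacian (u 1%N) = alpha0 *: fk 1%N + u 0%N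
    %[ae lebesgue_on oOmega] ->
  (forall k, (1 <= k <= K - 1)%N ->
    u k.+1 + alpha0 *: negLaplacian (u k.+1) =
      alpha0 *: fk k.+1 + (1 - b 1%N) *: u k
      + \sum_(1 <= j < k) (b j - b j.+1) *: u (k - j)%N + b k *: u 0%N
      %[ae lebesgue_on oOmega]) ->
  forall k, (1 <= k <= K)%N ->
    L2norm (u k) <= L2norm (u 0%N) + alpha0 * k%:R * Linfty_norm T f.
Proof.
move=> dt fk b alpha0 _ uA e1 eS.
have alpha0_ge0 : 0 <= alpha0 by rewrite mulr_ge0 ?Gamma_ge0 ?powR_ge0.
set F := Linfty_norm T f.
have fkF k : (k <= K)%N -> L2norm (fk k) <= F.
  move=> kK; apply: ub_le_sup => //; exists (k%:R * dt) => //=.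
  have K0 : 0 < K%:R :> R by rewrite ltr0n.
  rewrite in_itv/= /dt mulr_ge0 ?divr_ge0 ?(ltW hT)//=.
  by rewrite mulrA ler_pdivrMr// mulrC ler_pM2l// ler_nat.
have F0 : 0 <= F.
  by apply: le_trans (fkF 0%N isT); rewrite fine_ge0// Lnorm_ge0.
have sourceF k : (k <= K)%N -> L2norm (alpha0 *: fk k) <= alpha0 * F.
  by move=> kK; rewrite /L2norm L2_normZ ger0_norm// ler_wpM2l// fkF.
have normZ c (v : L2 oOmega) : 0 <= c -> L2norm (c *: v) = c * L2norm v.
  by move=> c0; rewrite /L2norm L2_normZ ger0_norm.
(* Each step involves the whole history, so the induction carries one bound, nondecreasing in [k],
   valid for all [u j] with [j <= k], including [u 0]. *)
suff H k : (k <= K)%N -> forall j, (j <= k)%N ->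
    L2norm (u j) <= L2norm (u 0%N) + alpha0 * k%:R * F.
  by move=> k /andP[_ kK]; exact: (H k kK k).
elim: k => [_ j|k IH kK j].
  by rewrite leqn0 => /eqP ->; rewrite mulr0 mul0r addr0.
have {}IH := IH (ltnW kK).
rewrite leq_eqVlt => /predU1P[->|]; last first.
  rewrite ltnS => /IH/le_trans; apply.
  by rewrite lerD2l ler_wpM2r// ler_wpM2l// ler_nat.
have uk0 := negLaplacian_ge0 (uA k.+1 kK).
apply: (@le_trans _ _ (alpha0 * F + (L2norm (u 0%N) + alpha0 * k%:R * F)));
  last by rewrite -natr1; lra.
(* The first step has its own equation: at [k = 0] the general right-hand side would carry the extra
   term [(1 - b 1) *: u 0]. *)
have [k0|k0] := posnP k.
  move: uk0; rewrite k0 => uk0.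
  apply: (le_trans (accretive_norm_le alpha0_ge0 uk0 e1)).
  apply: (le_trans (L2_normD _ _)).
  by rewrite mulr0 mul0r addr0 lerD2r; exact: (sourceF 1%N).
have kK1 : (1 <= k <= K - 1)%N by rewrite k0 subn1 -ltnS prednK.
apply: (le_trans (accretive_norm_le alpha0_ge0 uk0 (eS k kK1))).
rewrite -!addrA.
apply: (le_trans (L2_normD _ _)); apply: lerD; first exact: sourceF.
(* The convex combination is taken of the norms of the [u j]; what remains is the triangle
   inequality, with nonnegative weights leaving the norm unchanged. *)
apply: le_trans (b_convex_combination_le halpha k0 IH).
rewrite addrA.
apply: (le_trans (L2_normD _ _)); apply: lerD; last first.
  by rewrite -[X in X <= _]/(L2norm _) normZ// b_ge0.
apply: (le_trans (L2_normD _ _)); apply: lerD.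
  rewrite -[X in X <= _]/(L2norm _) normZ//.
  by rewrite subr_ge0 -(b_0 halpha) b_nonincreasing.
apply: (le_trans (L2_norm_sum _ _)); apply: ler_sum => i _.
rewrite -[X in X <= _]/(L2norm _) normZ//.
by rewrite subr_ge0 b_nonincreasing.
Qed.
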